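(* Let $\mathcal E,\mathcal A\in\mathbb R^{n\times n}$, $\mathcal B\in\mathbb R^{n\times m}$, $\mathcal C\in\mathbb R^{k\times n}$, $\mathcal F\in\mathbb R^{\ell\times n}$ and $t_1>0$ satisfy the standing hypotheses (H1)–(H4) of the context, let $\mathcal P_+$ be the stabilizing solution fixed there, $\mathcal A_+:=\mathcal A-\mathcal B\mathcal B^*\mathcal P_+$, and let $\mathcal P$ be the solution for $t\le t_1$ of the generalized differential Riccati equation specified in the context. Then the system $$\begin{bmatrix}\mathcal E&0\\ 0&\mathcal E^*\end{bmatrix}\frac{d}{dt}\begin{bmatrix}V_1\\ \tilde V_2\end{bmatrix}=\begin{bmatrix}\mathcal A_+&-\mathcal B\mathcal B^*\\ 0&-\mathcal A_+^*\end{bmatrix}\begin{bmatrix}V_1\\ \tilde V_2\end{bmatrix},\quad \mathcal EV_1(t_1)=\begin{bmatrix}I\\ 0\end{bmatrix},\quad \mathcal E\tilde V_2(t_1)=\begin{bmatrix}S-P_{+;1}\\ 0\end{bmatrix},$$ with $V_1(t),\tilde V_2(t)\in\mathbb R^{n\times d}$, has a unique solution, partitioned as $V_1=\begin{bmatrix}V_{11}\\ V_{12}\end{bmatrix}$, $\tilde V_2=\begin{bmatrix}\tilde V_{21}\\ \tilde V_{22}\end{bmatrix}$ with $V_{11}(t),\tilde V_{21}(t)\in\mathbb R^{d\times d}$, such that $V_{11}(t)$ is invertible for $t\le t_1$ and such that $\mathcal P_\Delta(t):=\mathcal P(t)-\mathcal P_+$ satisfies $$\mathcal P_\Delta(t)=\begin{bmatrix}P_{\Delta;1}(t)&0\\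 P_{\Delta;21}(t)&0\end{bmatrix}=\begin{bmatrix}P_{\Delta;1}(t)&0\\ -A_{+;2}^{-*}A_{+;12}^*P_{\Delta;1}(t)&0\end{bmatrix}=\begin{bmatrix}\tilde V_{21}(t)V_{11}(t)^{-1}&0\\ -A_{+;2}^{-*}A_{+;12}^*\tilde V_{21}(t)V_{11}(t)^{-1}&0\end{bmatrix}.$$
   Context: $M^*$ denotes the transpose, $M^{-*}:=(M^* )^{-1}$. Definitions: A pair $(\mathcal E,\mathcal A)$ is regular if $s\mathcal E-\mathcal A$ is invertible for some $s\in\mathbb C$. A regular pair is equivalent (by multiplication with invertible matrices from the left and right) to $\left(\begin{bmatrix}I&0\\ 0&N\end{bmatrix},\begin{bmatrix}J&0\\ 0&I\end{bmatrix}\right)$ with $J,N$ in Jordan form and $N$ nilpotent; it is finite dynamics stable if all eigenvalues of $J$ have negative real part. A regular pair is impulse-free if $\operatorname{rank}\begin{bmatrix}\mathcal E&0\\ \mathcal A&\mathcal E\end{bmatrix}=n+\operatorname{rank}\mathcal E$. The generalized algebraic Riccati equation (gARE) is $\mathcal A^*X+X^*\mathcal A-X^*\mathcal B\mathcal B^*X+\mathcal C^*\mathcal C=0$, $\mathcal E^*X=X^*\mathcal E$; a solution $\mathcal P_+$ is stabilizing if $(\mathcal E,\mathcal A-\mathcal B\mathcal B^*\mathcal P_+)$ is regular, impulse-free and finite dynamics stable. Standing hypotheses: (H1) $\mathcal E=\begin{bmatrix}I&0\\ 0&0\end{bmatrix}$ with $I\in\mathbb R^{d\times d}$. (H2) $\operatorname{range}\mathcal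 F^*\subset\operatorname{range}\mathcal E^*$; hence $\mathcal F^*\mathcal F=\begin{bmatrix}S&0\\ 0&0\end{bmatrix}$, which defines $S\in\mathbb R^{d\times d}$. (H3) $(\mathcal E,\mathcal A)$ is regular and the gARE has a stabilizing solution $\mathcal P_+$. (H4) With partitions conforming with $\mathcal E$, $\mathcal A=\begin{bmatrix}A_{11}&A_{12}\\ A_{21}&A_{22}\end{bmatrix}$, $\mathcal B=\begin{bmatrix}B_1\\ B_2\end{bmatrix}$, $\mathcal C=\begin{bmatrix}C_1&C_2\end{bmatrix}$, $\mathcal P_+=\begin{bmatrix}P_{+;1}&0\\ P_{+;21}&P_{+;2}\end{bmatrix}$ (block lower triangular with $P_{+;1}$ symmetric because $\mathcal E^*\mathcal P_+=\mathcal P_+^*\mathcal E$), $P_2:=P_{+;2}$ and the regular matrix $K_2:=A_{22}^*-P_2^*B_2B_2^*$, the matrix $C_1^*C_1-(A_{21}^*P_2+C_1^*C_2)K_2^{-*}A_{21}-A_{21}^*K_2^{-1}(C_2^*C_1+P_2^*A_{21})-(C_1^*C_2+A_{21}^*P_2)K_2^{-*}B_2B_2^*K_2^{-1}(C_2^*C_1+P_2^*A_{21})$ is positive semidefinite. Notation: $\mathcal A_+=\begin{bmatrix}A_{+;1}&A_{+;12}\\ A_{+;21}&A_{+;2}\end{bmatrix}$ conforming with $\mathcal E$; $A_{+;2}$ is invertible since $(\mathcal E,\mathcal A_+)$ is impulse-free. The generalized differential Riccati equation (gDRE) is $-\mathcal E^*\dot{\mathcal P}=\mathcal A^*\mathcal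 P+\mathcal P^*\mathcal A-\mathcal P^*\mathcal B\mathcal B^*\mathcal P+\mathcal C^*\mathcal C$, $\mathcal E^*\mathcal P(t_1)=\mathcal F^*\mathcal F$. Under (H1)–(H4) it has a solution for $t\le t_1$; $\mathcal P$ denotes the solution of block lower triangular form $\begin{bmatrix}P_1(t)&0\\ P_{21}(t)&P_2\end{bmatrix}$, $P_1(t)$ symmetric, with constant lower right block $P_2=P_{+;2}$. *)

(* Defs.v *)
From HB Require Import structures.
From mathcomp Require Import all_boot all_order all_algebra.
From mathcomp Require Import all_classical all_reals all_analysis.
From mathcomp Require Import complex.
Set Implicit Arguments.
Unset Strict Implicit.
Unset Printing Implicit Defensive.
Import Order.TTheory GRing.Theory Num.Theory.
Import numFieldNormedType.Exports.
Local Open Scope classical_set_scope.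
Local Open Scope ring_scope.

Section MatrixNotions.
Variable R : realType.

Definition complexify (m n : nat) (M : 'M[R]_(m, n)) : 'M[R[i]]_(m, n) :=
  map_mx (real_complex R) M.

Definition colrange (m n : nat) (M : 'M[R]_(m, n)) : set 'cV[R]_m :=
  [set M *m x | x in [set: 'cV[R]_n]].

Definition psd (n : nat) (M : 'M[R]_n) : Prop :=
  M^T = M /\ forall x : 'cV[R]_n, 0 <= (x^T *m M *m x) 0 0.

End MatrixNotions.

Section Pairs.
Variable R : realType.

Definition jordan_block (K : fieldType) (p : nat) (a : K) : 'M[K]_p :=
  \matrix_(i, j) (if j == i then a else if (j == i.+1 :> nat) then 1 else 0).

Definition is_jordan_form (K : fieldType) (r : nat) (J : 'M[K]_r) : Prop :=
  exists (m : nat) (p : 'I_m -> nat) (a : 'I_m -> K)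
         (e : (\sum_(i < m) p i)%N = r),
    J = castmx (e, e) (\mxdiag_(i < m) jordan_block (p i) (a i)).

Definition nilpotent_mx (K : fieldType) (p : nat) (N : 'M[K]_p) : Prop :=
  exists k : nat, N ^+ k = 0.

Definition regular_pair (n : nat) (E A : 'M[R]_n) : Prop :=
  exists s : R[i], s *: complexify E - complexify A \in unitmx.

Definition weierstrass_form (n : nat) (E A : 'M[R]_n) (r p : nat)
    (J : 'M[R[i]]_r) (N : 'M[R[i]]_p) : Prop :=
  [/\ is_jordan_form J, is_jordan_form N, nilpotent_mx N &
    exists (e : (r + p)%N = n) (W T : 'M[R[i]]_n),
    [/\ W \in unitmx, T \in unitmx,
        W *m complexify E *m T = castmx (e, e) (block_mx 1%:M 0 0 N) &
        W *m complexify A *m T = castmx (e, e) (block_mx J 0 0 1%:M)]].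

Definition finite_dynamics_stable (n : nat) (E A : 'M[R]_n) : Prop :=
  exists (r p : nat) (J : 'M[R[i]]_r) (N : 'M[R[i]]_p),
    weierstrass_form E A J N /\
    forall a : R[i], eigenvalue J a -> complex.Re a < 0.

Definition impulse_free (n : nat) (E A : 'M[R]_n) : Prop :=
  \rank (block_mx E 0 A E) = (n + \rank E)%N.

End Pairs.

Section Riccati.
Variable R : realType.

Definition closed_loop (n m : nat) (A : 'M[R]_n) (B : 'M[R]_(n, m))
    (X : 'M[R]_n) : 'M[R]_n :=
  A - B *m B^T *m X.

Definition gARE_solution (n m k : nat) (E A : 'M[R]_n) (B : 'M[R]_(n, m))
    (C : 'M[R]_(k, n)) (X : 'M[R]_n) : Prop :=
  A^T *m X + X^T *m A - X^T *m B *m B^T *m X + C^T *m C = 0 /\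
  E^T *m X = X^T *m E.

Definition gARE_stabilizing (n m k : nat) (E A : 'M[R]_n) (B : 'M[R]_(n, m))
    (C : 'M[R]_(k, n)) (X : 'M[R]_n) : Prop :=
  [/\ gARE_solution E A B C X,
      regular_pair E (closed_loop A B X),
      impulse_free E (closed_loop A B X) &
      finite_dynamics_stable E (closed_loop A B X)].

(* The derivative at t of a function defined for times <= t1, relative to
   that domain: two-sided for t < t1, left-sided for t = t1. *)
Definition has_deriv_upto (t1 : R) (m n : nat) (f : R -> 'M[R]_(m, n))
    (t : R) (df : 'M[R]_(m, n)) : Prop :=
  (fun s => (s - t)^-1 *: (f s - f t)) @ within [set s | s <= t1] t^' --> df.

Definition gDRE_solution (n m k l : nat) (E A : 'M[R]_n) (B : 'M[R]_(n, m))
    (C : 'M[R]_(k, n)) (F : 'M[R]_(l, n)) (t1 : R) (P : R -> 'M[R]_n) : Prop :=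
  (forall t : R, t <= t1 -> exists2 dP : 'M[R]_n, has_deriv_upto t1 P t dP &
     - (E^T *m dP) =
       A^T *m P t + (P t)^T *m A - (P t)^T *m B *m B^T *m P t + C^T *m C) /\
  E^T *m P t1 = F^T *m F.

Variables d q : nat.

Definition gDRE_block_solution (m k l : nat) (E A : 'M[R]_(d + q))
    (B : 'M[R]_(d + q, m)) (C : 'M[R]_(k, d + q)) (F : 'M[R]_(l, d + q))
    (t1 : R) (P2 : 'M[R]_q) (P : R -> 'M[R]_(d + q)) : Prop :=
  gDRE_solution E A B C F t1 P /\
  forall t : R, t <= t1 -> exists (P1 : 'M[R]_d) (P21 : 'M[R]_(q, d)),
    P1^T = P1 /\ P t = block_mx P1 0 P21 P2.

Definition H4_matrix (m k : nat) (A : 'M[R]_(d + q)) (B : 'M[R]_(d + q, m))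
    (C : 'M[R]_(k, d + q)) (P2 : 'M[R]_q) : 'M[R]_d :=
  let A21 := dlsubmx A in
  let A22 := drsubmx A in
  let B2 := dsubmx B in
  let C1 := lsubmx C in
  let C2 := rsubmx C in
  let K2 := A22^T - P2^T *m B2 *m B2^T in
  C1^T *m C1
  - (A21^T *m P2 + C1^T *m C2) *m invmx (K2^T) *m A21
  - A21^T *m invmx K2 *m (C2^T *m C1 + P2^T *m A21)
  - (C1^T *m C2 + A21^T *m P2) *m invmx (K2^T) *m B2 *m B2^T
      *m invmx K2 *m (C2^T *m C1 + P2^T *m A21).

Definition V_system_solution (m : nat) (E Ap : 'M[R]_(d + q))
    (B : 'M[R]_(d + q, m)) (t1 : R) (V1_end V2_end : 'M[R]_d)
    (V1 V2 : R -> 'M[R]_(d + q, d)) : Prop :=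
  [/\ forall t : R, t <= t1 ->
        exists2 dV : 'M[R]_((d + q) + (d + q), d),
          has_deriv_upto t1 (fun s => col_mx (V1 s) (V2 s)) t dV &
          block_mx E 0 0 E^T *m dV =
          block_mx Ap (- (B *m B^T)) 0 (- Ap^T) *m col_mx (V1 t) (V2 t),
      E *m V1 t1 = col_mx V1_end 0 &
      E *m V2 t1 = col_mx V2_end 0].

End Riccati.

(* Main.v *)
Require Import Defs.
From HB Require Import structures.
From mathcomp Require Import all_boot all_order all_algebra.
From mathcomp Require Import all_classical all_reals all_analysis.
From mathcomp Require Import complex.
From mathcomp Require Import zify ring lra.
Set Implicit Arguments.
Unset Strict Implicit.
Unset Printing Implicit Defensive.
Import Order.TTheory GRing.Theory Num.Theory.
Import numFieldNormedType.Exports.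
Local Open Scope classical_set_scope.
Local Open Scope ring_scope.

(** Since E is diag(I, 0) and the closed-loop pencil is impulse-free, the lower
right block of A_+ is invertible ([impulse_free_rank_unitmx]), so the algebraic
rows of every differential-algebraic equation involved can be solved
([dae_reduction]).  Write A_+ = [a b; c e], let As = a - b e^-1 c be its Schur
complement, L = [I; - e^-* b^*] and Q = L^* B B^* L.

Subtracting the algebraic Riccati equation from the differential one gives a
Riccati equation for P - P_+ without constant term ([riccati_difference]).  Its
lower left block says that the first block column of P - P_+ is L D with D the
upper left block, and its upper left block reduces to
- D' = As^* D + D As - D Q D ([block_riccati]).

Likewise the boundary value problem for (V_1, V_2) is equivalent to expressing
both unknowns through their upper halves Z = (V_11, V_21), subject to the linear
equation Z' = H Z with H = [As, -Q; 0, -As^*] ([hamiltonian_daeP]).  Existence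
follows from the power series of the matrix exponential ([linear_ode_exists])
and uniqueness from an energy estimate ([linear_ode_eq0]).

Finally V_21 - D V_11 solves a homogeneous linear equation and vanishes at t_1,
so V_21 = D V_11 throughout.  Hence V_11' = (As - Q D) V_11 with V_11(t_1) = I,
and a kernel vector of V_11(t) would, by uniqueness, be a kernel vector of I.
Thus V_11 is invertible and D = V_21 V_11^-1 ([riccati_linearization]). *)

(** * Derivatives relative to a left half-line *)

Lemma near_eq_cvg_to (U : Type) (V : topologicalType) (F : set_system U)
    (f g : U -> V) (l : V) : Filter F ->
  f @ F --> l -> (\forall x \near F, f x = g x) -> g @ F --> l.
Proof.
by move=> FF fl fg; exact: (cvg_trans (near_eq_cvg fg) fl).
Qed.

Section LeftHalfLineDerivative.
Variable R : realType.
Implicit Types (f g : R -> R) (T t : R).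

(** The entrywise counterpart of [has_deriv_upto]. *)
Definition deriv_upto T f t (df : R) : Prop :=
  (fun s => (s - t)^-1 * (f s - f t)) @ within [set s | s <= T] t^' --> df.

Lemma filter_upto T t : Filter (within [set s | s <= T] t^').
Proof. exact: within_filter. Qed.
#[local] Existing Instance filter_upto.

Lemma deriv_upto_cvg T f t df : deriv_upto T f t df ->
  f @ within [set s | s <= T] t^' --> f t.
Proof.
move=> fdf.
have h0 : (fun s => s - t) @ t --> (0 : R).
  rewrite -[X in _ --> X](subrr t).
  by apply: cvgB; [exact: cvg_id|exact: cvg_cst].
have st : (fun s => s - t) @ within [set s | s <= T] t^' --> (0 : R).
  do 2 apply: cvg_within_filter.
  exact: h0.
have FF := filter_upto T t.
have := cvgD (FF := FF) (cvg_cst (FF := FF) (f t)) (cvgM (FF := FF) st fdf).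
rewrite mul0r addr0 => lim; apply: (near_eq_cvg_to _ lim).
rewrite !near_withinE; apply: nearW => s snt _.
change (f t + (s - t) * ((s - t)^-1 * (f s - f t)) = f s).
by rewrite mulrA divff ?subr_eq0// mul1r; ring.
Qed.

Lemma deriv_upto_cst T (c : R) t : deriv_upto T (fun=> c) t 0.
Proof.
rewrite /deriv_upto; under eq_fun do rewrite subrr mulr0; exact: cvg_cst.
Qed.

Lemma deriv_uptoD T f g t df dg : deriv_upto T f t df -> deriv_upto T g t dg ->
  deriv_upto T (fun s => f s + g s) t (df + dg).
Proof.
move=> fd gd; have FF := filter_upto T t.
apply: (near_eq_cvg_to _ (cvgD (FF := FF) fd gd)).
apply: nearW => s.
change ((s - t)^-1 * (f s - f t) + (s - t)^-1 * (g s - g t) =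
  (s - t)^-1 * (f s + g s - (f t + g t))).
ring.
Qed.

Lemma deriv_uptoM T f g t df dg : deriv_upto T f t df -> deriv_upto T g t dg ->
  deriv_upto T (fun s => f s * g s) t (df * g t + f t * dg).
Proof.
move=> fd gd.
have FF := filter_upto T t.
have lim := cvgD (FF := FF) (cvgM (FF := FF) fd (deriv_upto_cvg gd))
  (cvgM (FF := FF) (cvg_cst (FF := FF) (f t)) gd).
apply: (near_eq_cvg_to _ lim); apply: nearW => s.
change ((s - t)^-1 * (f s - f t) * g s + f t * ((s - t)^-1 * (g s - g t)) =
  (s - t)^-1 * (f s * g s - f t * g t)).
ring.
Qed.

Lemma deriv_upto_sum T (I : finType) (f : I -> R -> R) t (df : I -> R) :
  (forall i, deriv_upto T (f i) t (df i)) ->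
  deriv_upto T (fun s => \sum_i f i s) t (\sum_i df i).
Proof.
move=> fd; rewrite /deriv_upto.
have -> : (fun s => (s - t)^-1 * (\sum_i f i s - \sum_i f i t)) =
    (fun s => \sum_i (s - t)^-1 * (f i s - f i t)).
  by apply/funext => s; rewrite -sumrB mulr_sumr.
by apply: cvg_big => [|i _]; [exact: add_continuous|exact: fd].
Qed.

Lemma cvg_dnbhs_add (a t : R) : (fun s => s + a) @ t^' --> (t + a)^'.
Proof.
have h : (fun s => s + a) @ t --> t + a.
  by apply: cvgD; [exact: cvg_id|exact: cvg_cst].
move=> A hA.
have hA' : nbhs t [set s | s + a != t + a -> A (s + a)] by exact: h _ hA.
apply: (@filterS _ (nbhs t) (nbhs_filter t) _ _ _ hA') => s /= + st.
by apply; rewrite (inj_eq (addIr a)).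
Qed.

Lemma is_derive_deriv_upto T f t df : is_derive t 1 f df -> deriv_upto T f t df.
Proof.
move=> [fd <-]; rewrite /deriv_upto; apply: cvg_within_filter.
have h := @cvg_dnbhs_add (- t) t; rewrite subrr in h.
have fd' : h^-1 *: ((f \o shift t) (h *: 1) - f t) @[h --> (0 : R)^'] -->
  'D_1 f t by exact: fd.
have lim := cvg_comp _ _ h fd'.
apply: (near_eq_cvg_to _ lim); apply: nearW => s /=.
by rewrite /GRing.scale /= mulr1 subrK.
Qed.

Lemma deriv_upto_is_derive T f t df : t < T -> deriv_upto T f t df ->
  is_derive t 1 f df.
Proof.
move=> tT fd.
have fd' : (fun s => (s - t)^-1 * (f s - f t)) @ t^' --> df.
  move=> A hA.
  have hA' : nbhs t [set s | s != t -> s <= T -> A ((s - t)^-1 * (f s - f t))].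
    exact: fd _ hA.
  have tT' : nbhs t [set s | s < T] by exact: lt_nbhsl.
  apply: (@filterS2 _ (nbhs t) (nbhs_filter t) _ _ _ _ hA' tT').
  by move=> s /= + sT st => /(_ st); apply; exact: ltW.
have h := @cvg_dnbhs_add t 0; rewrite add0r in h.
have q : h^-1 *: ((f \o shift t) (h *: 1) - f t) @[h --> (0 : R)^'] --> df.
  apply: (near_eq_cvg_to _ (cvg_comp _ _ h fd')).
  by apply: nearW => s /=; rewrite addrK /GRing.scale /= mulr1.
by split; [apply/cvg_ex; exists df|exact/cvg_lim].
Qed.

(** Left of [T] the relative derivative is an ordinary one; only at the end
point [T] is continuity merely one-sided. *)
Lemma deriv_upto_within_continuous T f a b : b <= T ->
  (forall t, t <= T -> exists df, deriv_upto T f t df) ->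
  {within `[a, b], continuous f}.
Proof.
move=> bT fd.
have : {within `]-oo, T], continuous f}.
  apply/continuous_within_itvNycP; split.
    move=> t; rewrite in_itv /= => tT.
    apply/differentiable_continuous/derivable1_diffP.
    have [df fdt] := fd t (ltW tT).
    by have [] := deriv_upto_is_derive tT fdt.
  have [df /deriv_upto_cvg fT] := fd T (lexx T) => A hA.
  have hA' : nbhs T [set s | s != T -> s <= T -> A (f s)] by exact: fT _ hA.
  apply: (@filterS _ (nbhs T) (nbhs_filter T) _ _ _ hA') => s /= + sT.
  by apply; [rewrite lt_eqF|exact: ltW].
apply: continuous_subspaceW => s /=; rewrite !in_itv /= => /andP[_ sb].
exact: le_trans bT.
Qed.

Lemma deriv_upto_expR T (c t : R) :
  deriv_upto T (fun s => expR (c * s)) t (c * expR (c * t)).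
Proof.
apply: is_derive_deriv_upto; rewrite mulrC.
have -> : (fun s => expR (c * s)) = (@expR R) \o (fun s => c * s) by [].
apply: is_derive1_comp.
rewrite -[X in is_derive _ _ _ X]mulr1.
exact: is_deriveZ.
Qed.

Lemma deriv_upto_ge0_le T f (df : R -> R) a b : a <= b -> b <= T ->
  (forall t, t <= T -> deriv_upto T f t (df t)) ->
  (forall t, a <= t <= b -> 0 <= df t) -> f a <= f b.
Proof.
move=> ab bT fd df0.
have fd' t : t \in `]a, b[%R -> is_derive t 1 f (df t).
  rewrite in_itv /= => /andP[_ /lt_le_trans/(_ bT) tT].
  exact: deriv_upto_is_derive tT (fd t (ltW tT)).
have fc : {within `[a, b], continuous f}.
  by apply: deriv_upto_within_continuous bT _ => t /fd; exists (df t).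
have [t + +] := MVT_segment ab fd' fc.
rewrite in_itv /= => tab; rewrite -subr_ge0 => ->.
by rewrite mulr_ge0 ?df0 ?subr_ge0.
Qed.

(** The estimate on [u'] makes [u * exp (c t)] nondecreasing and
[u * exp (- c t)] nonincreasing, so a zero of the nonnegative [u] propagates in
both directions of time. *)
Lemma gronwall_eq0 T (u du : R -> R) (c a b : R) : a <= b -> b <= T ->
  (forall t, t <= T -> deriv_upto T u t (du t)) ->
  (forall t, 0 <= u t) ->
  (forall t, a <= t <= b -> `|du t| <= c * u t) ->
  (u a = 0 <-> u b = 0).
Proof.
move=> ab bT ud u0 uc.
have eq0 t x : u t * expR x <= 0 -> u t = 0.
  by rewrite pmulr_lle0 ?expR_gt0// => ut; apply/eqP; rewrite eq_le ut u0.
have D (k : R) t : t <= T -> deriv_upto T (fun s => u s * expR (k * s)) t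
    ((du t + k * u t) * expR (k * t)).
  move=> tT; have := deriv_uptoM (ud t tT) (@deriv_upto_expR T k t).
  by congr (deriv_upto _ _ _); ring.
have ND (k : R) t : t <= T ->
    deriv_upto T (fun s => -1 * (u s * expR (k * s))) t (-1 * ((du t + k * u t) * expR (k * t))).
  move=> tT; have := deriv_uptoM (deriv_upto_cst T (-1) t) (D k t tT).
  by rewrite mul0r add0r.
split=> [ua|ub].
- have := deriv_upto_ge0_le ab bT (ND (- c)).
  rewrite ua mul0r mulr0 mulN1r oppr_ge0.
  move=> /(_ _)/eq0; apply => t /uc; rewrite ler_norml => /andP[_ h].
  rewrite mulN1r -mulNr mulr_ge0 ?expR_ge0//; lra.
- have := deriv_upto_ge0_le ab bT (D c); rewrite ub mul0r.
  move=> /(_ _)/eq0; apply => t /uc; rewrite ler_norml => /andP[h _].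
  rewrite mulr_ge0 ?expR_ge0//; lra.
Qed.
End LeftHalfLineDerivative.

(** * Matrix-valued derivatives and uniqueness for linear equations *)

Section MatrixODE.
Variable R : realType.
Implicit Types (T t a b : R).

Lemma has_deriv_uptoP (m n : nat) T (f : R -> 'M[R]_(m, n)) t df :
  has_deriv_upto T f t df <->
  forall i j, deriv_upto T (fun s => f s i j) t (df i j).
Proof.
have FF := filter_upto T t.
split=> [fd i j|fd].
  have lim := cvg_comp _ _ fd (@coord_continuous R m n i j df).
  apply: (near_eq_cvg_to FF lim); apply: (@nearW _ _ _ FF) => s /=.
  by rewrite !mxE.
apply/cvg_mx_entourageP => A entA.
apply: (filter_forall FF) => i; apply: (filter_forall FF) => j.
have h := fd i j _ (nbhs_entourage (df i j) entA).
apply: (filterS (Filter := FF) _ h) => s /=.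
by rewrite !mxE => /xsectionP; exact: mem_set.
Qed.

Lemma has_deriv_upto_cst (m n : nat) T (M : 'M[R]_(m, n)) t :
  has_deriv_upto T (fun=> M) t 0.
Proof. by apply/has_deriv_uptoP => i j; rewrite mxE; exact: deriv_upto_cst. Qed.

Lemma has_deriv_uptoD (m n : nat) T (f g : R -> 'M[R]_(m, n)) t df dg :
  has_deriv_upto T f t df -> has_deriv_upto T g t dg ->
  has_deriv_upto T (fun s => f s + g s) t (df + dg).
Proof.
move=> /has_deriv_uptoP fd /has_deriv_uptoP gd; apply/has_deriv_uptoP => i j.
by rewrite mxE; under eq_fun do rewrite mxE; exact: deriv_uptoD.
Qed.

Lemma has_deriv_uptoM (m n p : nat) T (f : R -> 'M[R]_(m, n))
    (g : R -> 'M[R]_(n, p)) t df dg :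
  has_deriv_upto T f t df -> has_deriv_upto T g t dg ->
  has_deriv_upto T (fun s => f s *m g s) t (df *m g t + f t *m dg).
Proof.
move=> /has_deriv_uptoP fd /has_deriv_uptoP gd; apply/has_deriv_uptoP => i j.
rewrite !mxE -big_split /=; under eq_fun do rewrite mxE.
by apply: deriv_upto_sum => l; exact: deriv_uptoM.
Qed.

Lemma has_deriv_upto_mull (m n p : nat) T (M : 'M[R]_(m, n))
    (f : R -> 'M[R]_(n, p)) t df :
  has_deriv_upto T f t df -> has_deriv_upto T (fun s => M *m f s) t (M *m df).
Proof.
move=> fd; have := has_deriv_uptoM (has_deriv_upto_cst T M t) fd.
by rewrite mul0mx add0r.
Qed.

Lemma has_deriv_upto_mulr (m n p : nat) T (M : 'M[R]_(n, p))
    (f : R -> 'M[R]_(m, n)) t df :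
  has_deriv_upto T f t df -> has_deriv_upto T (fun s => f s *m M) t (df *m M).
Proof.
move=> fd; have := has_deriv_uptoM fd (has_deriv_upto_cst T M t).
by rewrite mulmx0 addr0.
Qed.

Lemma has_deriv_uptoN (m n : nat) T (f : R -> 'M[R]_(m, n)) t df :
  has_deriv_upto T f t df -> has_deriv_upto T (fun s => - f s) t (- df).
Proof.
have e (M : 'M[R]_(m, n)) : - M = (-1)%:M *m M.
  by rewrite mul_scalar_mx scaleN1r.
move=> fd; rewrite e; under eq_fun do rewrite e.
exact: has_deriv_upto_mull.
Qed.

Lemma has_deriv_upto_usubmx (m n p : nat) T (f : R -> 'M[R]_(m + n, p)) t df :
  has_deriv_upto T f t df ->
  has_deriv_upto T (fun s => usubmx (f s)) t (usubmx df).
Proof.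
move=> /has_deriv_uptoP fd; apply/has_deriv_uptoP => i j.
by rewrite mxE; under eq_fun do rewrite mxE; exact: fd.
Qed.

Lemma has_deriv_upto_dsubmx (m n p : nat) T (f : R -> 'M[R]_(m + n, p)) t df :
  has_deriv_upto T f t df ->
  has_deriv_upto T (fun s => dsubmx (f s)) t (dsubmx df).
Proof.
move=> /has_deriv_uptoP fd; apply/has_deriv_uptoP => i j.
by rewrite mxE; under eq_fun do rewrite mxE; exact: fd.
Qed.

Lemma has_deriv_upto_ulsubmx (m n p q : nat) T (f : R -> 'M[R]_(m + n, p + q))
    t df :
  has_deriv_upto T f t df ->
  has_deriv_upto T (fun s => ulsubmx (f s)) t (ulsubmx df).
Proof.
move=> /has_deriv_uptoP fd; apply/has_deriv_uptoP => i j.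
by rewrite !mxE; under eq_fun do rewrite !mxE; exact: fd.
Qed.

Lemma has_deriv_upto_col_mx (m n p : nat) T (f : R -> 'M[R]_(m, p))
    (g : R -> 'M[R]_(n, p)) t df dg :
  has_deriv_upto T f t df -> has_deriv_upto T g t dg ->
  has_deriv_upto T (fun s => col_mx (f s) (g s)) t (col_mx df dg).
Proof.
move=> /has_deriv_uptoP fd /has_deriv_uptoP gd; apply/has_deriv_uptoP => i j.
rewrite mxE; under eq_fun do rewrite mxE.
by case: (fintype.split i) => i'; [exact: fd|exact: gd].
Qed.

(** The squared Frobenius norm [u] of a solution satisfies [|u'| <= c u] on a
compact interval, because the continuous entries of [G] are bounded there.  Both
directions are used: backwards for uniqueness of final value problems, forwards
for the invertibility of fundamental solutions. *)
Lemma linear_ode_eq0 T (n p : nat) (G : R -> 'M[R]_n) (Y : R -> 'M[R]_(n, p))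
    a b : a <= b -> b <= T ->
  (forall t, t <= T -> exists dG, has_deriv_upto T G t dG) ->
  (forall t, t <= T -> has_deriv_upto T Y t (G t *m Y t)) ->
  (Y a = 0 <-> Y b = 0).
Proof.
move=> ab bT Gd Yd.
pose u t := \sum_i \sum_j Y t i j * Y t i j.
pose du t := \sum_i \sum_j
  ((G t *m Y t) i j * Y t i j + Y t i j * (G t *m Y t) i j).
have ud t : t <= T -> deriv_upto T u t (du t).
  move=> tT; have /has_deriv_uptoP Ydt := Yd t tT.
  by do 2 apply: deriv_upto_sum => ?; exact: deriv_uptoM.
have sqr_ge0 t i j : 0 <= Y t i j * Y t i j by rewrite -expr2 sqr_ge0.
have u0 t : 0 <= u t by do 2 apply: sumr_ge0 => ? _.
have term_le t i j : Y t i j * Y t i j <= u t.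
  rewrite /u (bigD1 i)//= (bigD1 j)//= -addrA lerDl addr_ge0 ?sumr_ge0// => *.
  exact: sumr_ge0.
(* Products of entries are dominated by the squared norm, by AM-GM. *)
have prod_le t i j k l : `|Y t i j| * `|Y t k l| <= u t.
  have := term_le t i j; have := term_le t k l.
  have := Num.Theory.sqr_ge0 (`|Y t i j| - `|Y t k l|).
  rewrite -!expr2 -(real_normK (num_real (Y t i j)))
    -(real_normK (num_real (Y t k l))); nra.
have u_eq0 t : u t = 0 <-> Y t = 0.
  split=> [ut|Yt]; last first.
    by rewrite /u Yt; do 2 (apply: big1 => ? _); rewrite mxE mulr0.
  apply/matrixP => i j; rewrite mxE; have := term_le t i j.
  rewrite ut -expr2 => h; apply/eqP; rewrite -sqrf_eq0 eq_le h sqr_ge0 //.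
have [K K0 GK] : exists2 K, 0 <= K &
    forall t, a <= t <= b -> forall i k, `|G t i k| <= K.
  have Gc i k : {within `[a, b], continuous (fun t => `|G t i k|)}.
    have : {within `[a, b], continuous (fun t => G t i k)}.
      apply: deriv_upto_within_continuous bT _ => t /Gd[dG] /has_deriv_uptoP Gdt.
      by exists (dG i k).
    by move=> c t; apply: cvg_comp (c t) _; exact: norm_continuous.
  have /choice[K' KP] ik : exists M, 0 <= M /\
      forall t, a <= t <= b -> `|G t ik.1 ik.2| <= M.
    have [c cab cM] := EVT_max ab (Gc ik.1 ik.2).
    by exists `|G c ik.1 ik.2|; split => // t tab; apply: cM; rewrite in_itv.
  exists (\sum_ik K' ik) => [|t tab i k].
    by apply: sumr_ge0 => ik _; have [] := KP ik.
  have [_ /(_ t tab) /= h] := KP (i, k); apply: le_trans h _.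
  rewrite (bigD1 (i, k))//= lerDl; apply: sumr_ge0 => ik _.
  by have [] := KP ik.
have uc t : a <= t <= b ->
    `|du t| <= (\sum_(i < n) \sum_(j < p) \sum_(k < n) (K + K)) * u t.
  move=> tab; rewrite /du mulr_suml (le_trans (ler_norm_sum _ _ _))//.
  apply: ler_sum => i _; rewrite mulr_suml (le_trans (ler_norm_sum _ _ _))//.
  apply: ler_sum => j _; rewrite mxE mulr_suml mulr_sumr -big_split /=.
  rewrite mulr_suml (le_trans (ler_norm_sum _ _ _))//; apply: ler_sum => k _.
  have e : G t i k * Y t k j * Y t i j + Y t i j * (G t i k * Y t k j) =
    2 * (G t i k * (Y t k j * Y t i j)) by ring.
  rewrite e !normrM (ger0_norm (ler0n _ 2)).
  have -> : (K + K) * u t = 2 * (K * u t) by ring.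
  by rewrite ler_pM2l// ler_pM ?mulr_ge0// GK.
rewrite -!u_eq0; exact: gronwall_eq0 ab bT ud u0 uc.
Qed.
End MatrixODE.

(** * Existence for linear equations with constant coefficients *)

Section MatrixExponential.
Variables (R : realType) (n p : nat) (H : 'M[R]_n).
Implicit Types (Y : 'M[R]_(n, p)) (x : R).

(** Coefficients of the entry [(i, j)] of the power series of exp(x H) Y.
Working with exp(x H) Y rather than exp(x H) turns the formal derivative of the
series into the same series for [H *m Y]. *)
Definition exp_mx_coeff Y (i : 'I_n) (j : 'I_p) (k : nat) : R :=
  (iter k (mulmx H) Y) i j / k`!%:R.

Definition exp_mx x Y : 'M[R]_(n, p) :=
  \matrix_(i, j) limn (pseries (exp_mx_coeff Y i j) x).

Lemma exp_mx_coeff_diffs Y i j :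
  pseries_diffs (exp_mx_coeff Y i j) = exp_mx_coeff (H *m Y) i j.
Proof.
apply/funext => k; rewrite /pseries_diffs /exp_mx_coeff -iterSr factS natrM.
by rewrite invfM mulrCA mulVKf.
Qed.

(** Geometric growth of H^k Y, by which the power series of exp(x H) Y is dominated
by a scalar exponential series. *)
Lemma iter_mulmx_bound Y : exists2 C, 0 <= C & exists2 K, 0 <= K &
  forall k i j, `|(iter k (mulmx H) Y) i j| <= C * K ^+ k.
Proof.
pose C := \sum_i \sum_j `|Y i j|; pose K := \sum_i \sum_j `|H i j|.
have C0 : 0 <= C by do 2 apply: sumr_ge0 => ? _.
have K0 : 0 <= K by do 2 apply: sumr_ge0 => ? _.
exists C => //; exists K => //; elim=> [|k IH] i j /=.
  rewrite expr0 mulr1 /C (bigD1 i)//= (bigD1 j)//= -addrA lerDl.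
  by rewrite addr_ge0 ?sumr_ge0// => *; rewrite sumr_ge0.
rewrite mxE (le_trans (ler_norm_sum _ _ _))//.
have -> : C * K ^+ k.+1 = K * (C * K ^+ k) by rewrite exprS mulrCA.
rewrite (@le_trans _ _ (\sum_l `|H i l| * (C * K ^+ k)))//.
  by apply: ler_sum => l _; rewrite normrM ler_wpM2l.
rewrite -mulr_suml ler_wpM2r ?mulr_ge0 ?exprn_ge0//.
by rewrite /K [leRHS](bigD1 i)//= lerDl sumr_ge0// => *; rewrite sumr_ge0.
Qed.

Lemma is_cvg_exp_mx_coeff Y i j x : cvgn (pseries (exp_mx_coeff Y i j) x).
Proof.
have [C C0 [K K0 CK]] := iter_mulmx_bound Y.
apply: normed_cvg; rewrite /=.
apply: (@series_le_cvg _ _ (C *: exp_coeff (K * `|x|))) => [k|k|k|].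
- exact: normr_ge0.
- by rewrite /exp_coeff /= mulr_ge0// divr_ge0// exprn_ge0// mulr_ge0.
- have -> : (C *: exp_coeff (K * `|x|)) k = C * K ^+ k / k`!%:R * `|x| ^+ k.
    change (C * ((K * `|x|) ^+ k / k`!%:R) = C * K ^+ k / k`!%:R * `|x| ^+ k).
    by rewrite exprMn; ring.
  rewrite /= /exp_mx_coeff normrM normrX normrM normfV normr_nat.
  by rewrite ler_wpM2r ?exprn_ge0// ler_wpM2r ?invr_ge0.
- exact/is_cvg_seriesZ/is_cvg_series_exp_coeff.
Qed.

Lemma exp_mx0 Y : exp_mx 0 Y = Y.
Proof.
apply/matrixP => i j; rewrite mxE; apply: lim_near_cst => //.
near=> m; rewrite /pseries /series /= -[m]prednK; last by near: m.
rewrite big_nat_recl// big1 => [|k _]; last by rewrite expr0n mulr0.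
by rewrite addr0 expr0 mulr1 /exp_mx_coeff /= divr1.
Unshelve. all: by end_near. Qed.

Lemma exp_mx_mulmx x Y : exp_mx x (H *m Y) = H *m exp_mx x Y.
Proof.
apply/matrixP => i j; rewrite !mxE; apply/cvg_lim => //.
have -> : pseries (exp_mx_coeff (H *m Y) i j) x =
    (fun N => \sum_k H i k * pseries (exp_mx_coeff Y k j) x N).
  apply/funext => N; rewrite /pseries /series /=.
  under [RHS]eq_bigr do rewrite mulr_sumr.
  rewrite exchange_big /=; apply: eq_bigr => l _.
  rewrite /exp_mx_coeff -iterSr /= mxE !mulr_suml; apply: eq_bigr => k _.
  by rewrite !mulrA.
apply: cvg_big => [|k _]; first exact: add_continuous.
rewrite mxE; apply: cvgMr; exact: is_cvg_exp_mx_coeff.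
Qed.

Lemma is_derive_exp_mx x Y i j :
  is_derive x 1 (fun s => exp_mx s Y i j) ((H *m exp_mx x Y) i j).
Proof.
rewrite -exp_mx_mulmx mxE; under eq_fun do rewrite mxE.
rewrite -exp_mx_coeff_diffs.
apply: (@pseries_snd_diffs _ _ (`|x| + 1)); rewrite ?exp_mx_coeff_diffs.
- exact: is_cvg_exp_mx_coeff.
- exact: is_cvg_exp_mx_coeff.
- exact: is_cvg_exp_mx_coeff.
- by rewrite [ltRHS]ger0_norm ?ltrDl// addr_ge0.
Qed.

End MatrixExponential.

Lemma linear_ode_exists (R : realType) (n p : nat) (H : 'M[R]_n)
    (Y0 : 'M[R]_(n, p)) (T t0 : R) : exists Y : R -> 'M[R]_(n, p),
  Y t0 = Y0 /\ forall t, has_deriv_upto T Y t (H *m Y t).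
Proof.
exists (fun t => exp_mx H (t - t0) Y0); rewrite subrr exp_mx0; split=> // t.
apply/has_deriv_uptoP => i j; apply: is_derive_deriv_upto.
have -> : (fun s => exp_mx H (s - t0) Y0 i j) =
  (fun s => exp_mx H s Y0 i j) \o (fun s => s - t0) by [].
rewrite -[X in is_derive _ _ _ X]mulr1.
apply: is_derive1_comp; first exact: is_derive_exp_mx.
by apply: is_derive_eq; rewrite subr0.
Qed.

(** * Impulse-free pencils and semi-explicit equations *)

(** The block matrix always has rank at most [d + d + rank e], where [e] is the
lower right block of [A]: it is a sum of three products of inner dimensions [d],
[d] and [q], the last one factoring through [e].  The rank hypothesis therefore
forces [e] to have full rank. *)
Lemma impulse_free_rank_unitmx (K : fieldType) (d q : nat) (A : 'M[K]_(d + q)) :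
  let E : 'M[K]_(d + q) := block_mx 1%:M 0 0 0 in
  \rank (block_mx E 0 A E) = (d + q + \rank E)%N -> drsubmx A \in unitmx.
Proof.
rewrite /= -{1}(submxK A).
set a := ulsubmx A; set b := ursubmx A; set c := dlsubmx A; set e := drsubmx A.
move=> rkA.
pose E1 : 'M[K]_(d + q) := block_mx 1%:M 0 0 0.
have rkE : \rank E1 = d.
  have -> : E1 = pid_mx d by rewrite /E1 pid_mx_block.
  by rewrite rank_pid_mx ?leq_addr.
(* M1 carries the columns met by the first identity block, M2 the row of the
   second one, and M3 what is left, namely e. *)
pose M1 := col_mx (col_mx 1%:M (0 : 'M[K]_(q, d))) (col_mx a c) *m
  row_mx (row_mx (1%:M : 'M[K]_d) (0 : 'M[K]_(d, q))) (0 : 'M[K]_(d, d + q)).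
pose M2 := col_mx (0 : 'M[K]_(d + q, d)) (col_mx 1%:M (0 : 'M[K]_(q, d))) *m
  row_mx (row_mx (0 : 'M[K]_d) b) (row_mx 1%:M (0 : 'M[K]_(d, q))).
pose M3 := col_mx (0 : 'M[K]_(d + q, q)) (col_mx (0 : 'M[K]_(d, q)) 1%:M) *m
  row_mx (row_mx (0 : 'M[K]_(q, d)) e) (0 : 'M[K]_(q, d + q)).
have defM : block_mx E1 0 (block_mx a b c e) E1 = M1 + M2 + M3.
  rewrite /M1 /M2 /M3 /E1 !mul_col_row !(mulmx0, mul0mx, mulmx1, mul1mx).
  by rewrite !(add_block_mx, add_col_mx, addr0, add0r).
have rk1 : (\rank M1 <= d)%N.
  by rewrite (leq_trans (mxrankM_maxr _ _))// rank_leq_row.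
have rk2 : (\rank M2 <= d)%N.
  by rewrite (leq_trans (mxrankM_maxr _ _))// rank_leq_row.
have rk3 : (\rank M3 <= \rank e)%N.
  rewrite (leq_trans (mxrankM_maxr _ _))//.
  have -> : row_mx (row_mx (0 : 'M[K]_(q, d)) e) (0 : 'M[K]_(q, d + q)) =
      e *m row_mx (row_mx 0 1%:M) 0.
    by rewrite !mul_mx_row !mulmx0 mulmx1.
  exact: mxrankM_maxl.
have rk12 := mxrank_add M1 M2; have rk123 := mxrank_add (M1 + M2) M3.
rewrite -row_free_unit /row_free eqn_leq rank_leq_row /=.
move: rkA; rewrite -/E1 rkE defM => rkA.
have := leq_trans rk123 (leq_add (leq_trans rk12 (leq_add rk1 rk2)) rk3).
rewrite rkA; lia.
Qed.

Section DAE.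
Variables (K : fieldType) (d q r : nat).
Implicit Types (a : 'M[K]_d) (b : 'M[K]_(d, q)).
Implicit Types (c : 'M[K]_(q, d)) (e : 'M[K]_q).

(** The second block row is purely algebraic and determines the lower half of
[w]; substituting it in the first one leaves the Schur complement. *)
Lemma dae_reduction a b c e (v w y : 'M[K]_(d + q, r)) : e \in unitmx ->
  block_mx 1%:M 0 0 0 *m v = block_mx a b c e *m w - y <->
  dsubmx w = invmx e *m (dsubmx y - c *m usubmx w) /\
  usubmx v = (a - b *m invmx e *m c) *m usubmx w -
             (usubmx y - b *m invmx e *m dsubmx y).
Proof.
move=> eU; rewrite -[v]vsubmxK -[w]vsubmxK -[y]vsubmxK !col_mxKu !col_mxKd.
move: (usubmx v) (dsubmx v) (usubmx w) (dsubmx w) (usubmx y) (dsubmx y).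
move=> v1 v2 w1 w2 y1 y2.
rewrite !mul_block_col !mul1mx !mul0mx !addr0 opp_col_mx add_col_mx.
have w2E : 0 = c *m w1 + e *m w2 - y2 <-> w2 = invmx e *m (y2 - c *m w1).
  split=> [/esym/eqP|->].
    rewrite subr_eq0 => /eqP <-.
    by rewrite [c *m w1 + _]addrC addrK mulKmx.
  by rewrite mulKVmx// [c *m w1 + _]addrC subrK subrr.
split=> [/eq_col_mx[v1E /w2E w2D]|[/[dup] w2D /w2E <- ->]];
  [split=> //|congr col_mx].
  rewrite v1E w2D !mulmxBl !mulmxBr !mulmxA.
  move: (a *m w1) (b *m invmx e *m y2) (b *m invmx e *m c *m w1) => x1 x2 x3.
  by apply/matrixP => i j; rewrite !mxE; ring.
rewrite w2D !mulmxBl !mulmxBr !mulmxA.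
move: (a *m w1) (b *m invmx e *m y2) (b *m invmx e *m c *m w1) => x1 x2 x3.
by apply/matrixP => i j; rewrite !mxE; ring.
Qed.
End DAE.

(** * Linearization of the Riccati equation *)

Section RiccatiLinearization.
Variables (R : realType) (d : nat) (T : R) (A Q : 'M[R]_d).
Variables D V1 V2 : R -> 'M[R]_d.
Hypothesis Dd : forall t, t <= T -> has_deriv_upto T D t
  (- (A^T *m D t + D t *m A - D t *m Q *m D t)).
Hypothesis V1d : forall t, t <= T -> has_deriv_upto T V1 t
  (A *m V1 t - Q *m V2 t).
Hypothesis V2d : forall t, t <= T -> has_deriv_upto T V2 t (- (A^T *m V2 t)).
Hypotheses (V1T : V1 T = 1%:M) (V2T : V2 T = D T).

(** Radon's lemma: a Riccati solution is the quotient of the two components of a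
linear Hamiltonian system with matching final values. *)
Lemma riccati_linearization t : t <= T ->
  V1 t \in unitmx /\ D t = V2 t *m invmx (V1 t).
Proof.
move=> tT.
(* The defect V2 - D V1 solves a homogeneous linear equation. *)
have W0 s : s <= T -> V2 s = D s *m V1 s.
  move=> sT; apply/eqP; rewrite -subr_eq0; apply/eqP.
  have := @linear_ode_eq0 _ T _ _ (fun s => D s *m Q - A^T)
    (fun s => V2 s - D s *m V1 s) _ _ sT (lexx T).
  move=> [||_]; last by apply; rewrite V1T V2T mulmx1 subrr.
  - move=> x xT; eexists; apply: has_deriv_uptoD (has_deriv_upto_cst _ _ _).
    exact: has_deriv_upto_mulr (Dd xT).
  - move=> x xT; have := has_deriv_uptoD (V2d xT)
      (has_deriv_uptoN (has_deriv_uptoM (Dd xT) (V1d xT))).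
    congr (has_deriv_upto _ _ _ _).
    rewrite !(mulmxBl, mulmxBr, mulmxDl, mulmxDr, mulNmx, mulmxN, mulmxA).
    set x1 := A^T *m V2 x; set x2 := _ *m V1 x; set x3 := _ *m V1 x.
    move: x1 x2 x3 (D x *m Q *m V2 x) (D x *m Q *m D x *m V1 x) => x1 x2 x3 x4 x5.
    by apply/matrixP => i j; rewrite !mxE; ring.
suff V1U : V1 t \in unitmx by split=> //; rewrite W0// mulmxK.
(* The columns of k^T span the kernel of V1 t, so V1 k^T vanishes at t and, by
   uniqueness, at T, where V1 is the identity. *)
rewrite -unitmx_tr -row_free_unit -kermx_eq0; apply/eqP.
set k := kermx _.
have Vk : V1 t *m k^T = 0.
  by apply: trmx_inj; rewrite trmx_mul trmxK trmx0; exact: mulmx_ker.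
have /= := @linear_ode_eq0 _ T _ _ (fun s => A - Q *m D s)
    (fun s => V1 s *m k^T) _ _ tT (lexx T).
move=> [||+ _].
- move=> x xT; eexists.
  exact: (has_deriv_uptoD (has_deriv_upto_cst T A x)
    (has_deriv_uptoN (has_deriv_upto_mull (M := Q) (Dd xT)))).
- move=> x xT; have := has_deriv_upto_mulr (M := k^T) (V1d xT).
  congr (has_deriv_upto _ _ _ _).
  by rewrite W0// !mulmxBl !mulmxA.
by move=> /(_ Vk); rewrite V1T mul1mx => /(congr1 trmx); rewrite trmxK trmx0.
Qed.
End RiccatiLinearization.

(** * Block reduction of the Riccati and Hamiltonian equations *)

(** Completing the square at the algebraic solution [X]: the constant term [G]
cancels and the linear part becomes the closed-loop matrix. *)
Lemma riccati_difference (K : comPzRingType) (n m : nat) (A X P G : 'M[K]_n)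
    (B : 'M[K]_(n, m)) :
  A^T *m X + X^T *m A - X^T *m B *m B^T *m X + G = 0 ->
  A^T *m P + P^T *m A - P^T *m B *m B^T *m P + G =
  (A - B *m B^T *m X)^T *m (P - X) + (P - X)^T *m (A - B *m B^T *m X)
  - (P - X)^T *m (B *m B^T) *m (P - X).
Proof.
move=> gare; rewrite -[LHS]subr0 -gare.
have trB (U V : 'M[K]_n) : (U - V)^T = U^T - V^T by exact: linearB.
rewrite !trB !trmx_mul !trmxK !(mulmxBl, mulmxBr) !mulmxA.
move: (A^T *m X) (A^T *m P) (X^T *m A) (P^T *m A) (X^T *m B *m B^T *m X)
  (P^T *m B *m B^T *m P) (X^T *m B *m B^T *m P) (P^T *m B *m B^T *m X).
move=> x1 x2 x3 x4 x5 x6 x7 x8.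
by apply/matrixP => i j; rewrite !mxE; ring.
Qed.

Section BlockRiccati.
Variables (K : fieldType) (d q : nat) (a : 'M[K]_d) (b : 'M[K]_(d, q))
  (c : 'M[K]_(q, d)) (e : 'M[K]_q) (T : 'M[K]_(d + q)).
Hypothesis eU : e \in unitmx.

Definition schur_compl : 'M[K]_d := a - b *m invmx e *m c.
(** A costate [w] obeying the algebraic rows of the adjoint equation is
[costate_emb] applied to its upper half. *)
Definition costate_emb : 'M[K]_(d + q, d) :=
  col_mx 1%:M (- (invmx e^T *m b^T)).
Definition reduced_quad : 'M[K]_d := costate_emb^T *m T *m costate_emb.

Lemma schur_compl_tr : schur_compl^T = a^T - c^T *m invmx e^T *m b^T.
Proof.
by rewrite /schur_compl linearB /= !trmx_mul trmx_inv mulmxA.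
Qed.

Lemma costate_emb_tr : costate_emb^T = row_mx 1%:M (- (b *m invmx e)).
Proof.
by rewrite /costate_emb tr_col_mx trmx1 linearN /= trmx_mul trmxK trmx_inv trmxK.
Qed.

Lemma costate_embM (p : nat) (Y : 'M[K]_(d + q, p)) :
  costate_emb^T *m Y = usubmx Y - b *m invmx e *m dsubmx Y.
Proof.
by rewrite costate_emb_tr -{1}[Y]vsubmxK mul_row_col mul1mx mulNmx.
Qed.

Lemma state_eqP (r : nat) (v w y : 'M[K]_(d + q, r)) :
  block_mx 1%:M 0 0 0 *m v = block_mx a b c e *m w - y <->
  w = col_mx (usubmx w) (invmx e *m (dsubmx y - c *m usubmx w)) /\
  usubmx v = schur_compl *m usubmx w - costate_emb^T *m y.
Proof.
rewrite (dae_reduction _ _ _ _ _ _ eU) costate_embM.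
split=> [[<- ->]|[wE ->]]; first by rewrite vsubmxK.
by split=> //; rewrite {1}wE col_mxKd.
Qed.

(** The adjoint equation has the transposed blocks, so this is [dae_reduction]
with [c^T] and [b^T] in place of [b] and [c]; its Schur complement is the transposed one. *)
Lemma costate_eqP (r : nat) (v w : 'M[K]_(d + q, r)) :
  block_mx 1%:M 0 0 0 *m v = - ((block_mx a b c e)^T *m w) <->
  w = costate_emb *m usubmx w /\ usubmx v = - (schur_compl^T *m usubmx w).
Proof.
have eTU : e^T \in unitmx by rewrite unitmx_tr.
have := dae_reduction a^T c^T b^T (- v) w 0 eTU.
rewrite tr_block_mx mulmxN subr0 => h; rewrite schur_compl_tr.
have -> : (block_mx 1%:M 0 0 0 *m v = - (block_mx a^T c^T b^T e^T *m w)) <->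
  - (block_mx 1%:M 0 0 0 *m v) = block_mx a^T c^T b^T e^T *m w.
  by split=> [->|<-]; rewrite opprK.
have u0 : usubmx (0 : 'M[K]_(d + q, r)) = 0 by exact: linear0.
have d0 : dsubmx (0 : 'M[K]_(d + q, r)) = 0 by exact: linear0.
have uN : usubmx (- v) = - usubmx v by exact: linearN.
rewrite h u0 d0 uN mulmx0 !subr0 sub0r /costate_emb mul_col_mx mul1mx.
rewrite mulNmx mulmxN mulmxA; split=> [[<- <-]|[wE ->]].
  by rewrite vsubmxK opprK.
by rewrite opprK; split=> //; rewrite {1}wE col_mxKd.
Qed.

(** The lower left block of the equation contains no derivative and is the
algebraic row of a costate equation, whence the factor [costate_emb]; inserting
it in the upper left block produces the reduced coefficients. *)
Lemma block_riccati (dP D1 : 'M[K]_d) (D21 : 'M[K]_(q, d))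
    (dP12 : 'M[K]_(d, q)) (dP21 : 'M[K]_(q, d)) (dP22 : 'M[K]_q) :
  let Ap := block_mx a b c e in
  let D := block_mx D1 0 D21 0 : 'M[K]_(d + q) in
  D1^T = D1 ->
  - (block_mx 1%:M 0 0 0 *m block_mx dP dP12 dP21 dP22) =
    Ap^T *m D + D^T *m Ap - D^T *m T *m D ->
  col_mx D1 D21 = costate_emb *m D1 /\
  dP = - (schur_compl^T *m D1 + D1 *m schur_compl - D1 *m reduced_quad *m D1).
Proof.
move=> Ap D D1s; pose X := col_mx D1 D21.
have -> : D^T *m T *m D = block_mx (X^T *m T *m X) 0 0 0.
  rewrite /D block_mxEh col_mx0 tr_row_mx trmx0 mul_col_mx mul_col_row.
  by rewrite !mul0mx !mulmx0.
rewrite /Ap /D !tr_block_mx !mulmx_block !trmx0.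
rewrite !(mul0mx, mulmx0, addr0, mul1mx).
rewrite !opp_block_mx !add_block_mx !(oppr0, addr0, add0r).
move=> /eq_block_mx[dPE _ D21E _].
have XE : X = costate_emb *m D1.
  rewrite /X /costate_emb mul_col_mx mul1mx; congr col_mx.
  have /eqP := esym D21E; rewrite addrC addr_eq0 => /eqP e21.
  by rewrite -[D21](mulKmx (_ : e^T \in unitmx)) ?unitmx_tr// e21 mulmxN
    mulNmx mulmxA.
split=> //; rewrite -[dP]opprK dPE XE trmx_mul D1s.
have D21D : D21 = - (invmx e^T *m b^T *m D1).
  by have := XE; rewrite /X /costate_emb mul_col_mx mulNmx => /eq_col_mx[].
have SD : a^T *m D1 + c^T *m D21 = schur_compl^T *m D1.
  by rewrite D21D schur_compl_tr mulmxBl mulmxN !mulmxA.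
have DS : D1 *m a + D21^T *m c = D1 *m schur_compl.
  by apply: trmx_inj; rewrite linearD /= !trmx_mul trmxK D1s SD.
by rewrite SD DS /reduced_quad !mulmxA.
Qed.

(** The matrices below act on the stacked upper halves of state and costate:
[hamiltonian] drives them, [state_rec] and [costate_rec] recover the full state
and costate from them. *)
Definition hamiltonian : 'M[K]_(d + d) :=
  block_mx schur_compl (- reduced_quad) 0 (- schur_compl^T).
Definition state_rec : 'M[K]_(d + q, d + d) :=
  block_mx 1%:M 0 (- (invmx e *m c)) (invmx e *m dsubmx (T *m costate_emb)).
Definition costate_rec : 'M[K]_(d + q, d + d) := row_mx 0 costate_emb.

Lemma hamiltonian_daeP (r : nat) (v1 v2 w1 w2 : 'M[K]_(d + q, r)) :
  let E := block_mx 1%:M 0 0 0 : 'M[K]_(d + q) in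
  let Ap := block_mx a b c e in
  let z := col_mx (usubmx w1) (usubmx w2) in
  block_mx E 0 0 E *m col_mx v1 v2 =
    block_mx Ap (- T) 0 (- Ap^T) *m col_mx w1 w2 <->
  [/\ w1 = state_rec *m z, w2 = costate_rec *m z &
      col_mx (usubmx v1) (usubmx v2) = hamiltonian *m z].
Proof.
move=> E Ap z.
have -> : block_mx E 0 0 E *m col_mx v1 v2 = col_mx (E *m v1) (E *m v2).
  by rewrite mul_block_col !mul0mx addr0 add0r.
have -> : block_mx Ap (- T) 0 (- Ap^T) *m col_mx w1 w2 =
    col_mx (Ap *m w1 - T *m w2) (- (Ap^T *m w2)).
  by rewrite mul_block_col !mulNmx mul0mx add0r.
have -> : costate_rec *m z = costate_emb *m usubmx w2.
  by rewrite mul_row_col mul0mx add0r.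
have -> : hamiltonian *m z = col_mx
    (schur_compl *m usubmx w1 - reduced_quad *m usubmx w2)
    (- (schur_compl^T *m usubmx w2)).
  by rewrite mul_block_col mul0mx add0r !mulNmx.
have w1E : w2 = costate_emb *m usubmx w2 -> state_rec *m z = col_mx (usubmx w1)
    (invmx e *m (dsubmx (T *m w2) - c *m usubmx w1)).
  move=> w2E; rewrite [in RHS]w2E mulmxA -mul_dsub_mx mul_block_col mul1mx mul0mx.
  by rewrite addr0 mulmxBr mulNmx !mulmxA addrC.
have qE : w2 = costate_emb *m usubmx w2 ->
    reduced_quad *m usubmx w2 = costate_emb^T *m (T *m w2).
  by move=> w2E; rewrite {2}w2E /reduced_quad !mulmxA.
split=> [/eq_col_mx[/state_eqP[w1D v1E] /costate_eqP[w2D v2E]]|].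
  by split; rewrite ?w1E// v1E v2E qE.
move=> [w1D w2D /eq_col_mx[v1E v2E]]; congr col_mx.
  by apply/state_eqP; split; [rewrite -w1E|rewrite -qE].
exact/costate_eqP.
Qed.
End BlockRiccati.

(** * The main theorem *)

Theorem theorem5p5 (R : realType) (d q m k l : nat)
    (E A : 'M[R]_(d + q)) (B : 'M[R]_(d + q, m)) (C : 'M[R]_(k, d + q))
    (F : 'M[R]_(l, d + q)) (t1 : R) (Pp : 'M[R]_(d + q))
    (P : R -> 'M[R]_(d + q))
    (t1_gt0 : 0 < t1)
    (H1 : E = block_mx 1%:M 0 0 0)
    (H2 : colrange F^T `<=` colrange E^T)
    (H3_regular : regular_pair E A)
    (H3_stabilizing : gARE_stabilizing E A B C Pp)
    (H4 : psd (H4_matrix A B C (drsubmx Pp)))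
    (HP : gDRE_block_solution E A B C F t1 (drsubmx Pp) P) :
  let S := ulsubmx (F^T *m F) in
  let Ap := closed_loop A B Pp in
  let Ap12 := ursubmx Ap in
  let Ap2 := drsubmx Ap in
  let solution := V_system_solution E Ap B t1 1%:M (S - ulsubmx Pp) in
  exists V1 V2 : R -> 'M[R]_(d + q, d),
    [/\ solution V1 V2,
        forall W1 W2 : R -> 'M[R]_(d + q, d), solution W1 W2 ->
          forall t : R, t <= t1 -> W1 t = V1 t /\ W2 t = V2 t &
        forall t : R, t <= t1 ->
          let V11 := usubmx (V1 t) in
          let V21 := usubmx (V2 t) in
          let PD := P t - Pp in
          let PD1 := ulsubmx PD in
          let PD21 := dlsubmx PD in
          [/\ V11 \in unitmx,
              PD = block_mx PD1 0 PD21 0,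
              PD = block_mx PD1 0 (- (invmx Ap2^T *m Ap12^T *m PD1)) 0 &
              PD = block_mx (V21 *m invmx V11) 0
                     (- (invmx Ap2^T *m Ap12^T *m (V21 *m invmx V11))) 0]].
Proof.
move=> S Ap Ap12 Ap2 solution.
have [[gare Esym] _ impf _] := H3_stabilizing.
have [[gdre Pt1] Pblock] := HP.
have eU : Ap2 \in unitmx.
  by move: impf; rewrite H1; exact: (@impulse_free_rank_unitmx R d q Ap).
(* The symmetry of E^T Pp makes Pp block lower triangular. *)
have [Pp12 Pp1s] : ursubmx Pp = 0 /\ (ulsubmx Pp)^T = ulsubmx Pp.
  move: Esym; rewrite H1 -[Pp]submxK !tr_block_mx !trmx1 !trmx0 !mulmx_block.
  rewrite !(mul1mx, mulmx1, mul0mx, mulmx0, addr0).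
  by move=> /eq_block_mx[p1s p12 _ _]; rewrite !block_mxKul !block_mxKur -p1s.
set a := ulsubmx Ap; set c := dlsubmx Ap.
have ApE : Ap = block_mx a Ap12 c Ap2 by rewrite submxK.
have ET : E^T = block_mx 1%:M 0 0 0 by rewrite H1 tr_block_mx trmx1 !trmx0.
pose T := B *m B^T; pose L := costate_emb Ap12 Ap2.
pose As := schur_compl a Ap12 c Ap2; pose Q := reduced_quad Ap12 Ap2 T.
have ulsubB (X Y : 'M[R]_(d + q)) : ulsubmx (X - Y) = ulsubmx X - ulsubmx Y.
  by apply/matrixP => i j; rewrite !mxE.
have ursubB (X Y : 'M[R]_(d + q)) : ursubmx (X - Y) = ursubmx X - ursubmx Y.
  by apply/matrixP => i j; rewrite !mxE.
have drsubB (X Y : 'M[R]_(d + q)) : drsubmx (X - Y) = drsubmx X - drsubmx Y.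
  by apply/matrixP => i j; rewrite !mxE.
pose D t := ulsubmx (P t - Pp).
have PDblock t : t <= t1 -> P t - Pp = block_mx (D t) 0 (dlsubmx (P t - Pp)) 0.
  move=> tt; have [P1 [P21 [_ PtE]]] := Pblock t tt.
  rewrite -{1}[P t - Pp]submxK; congr block_mx.
    by rewrite ursubB Pp12 PtE block_mxKur subrr.
  by rewrite drsubB PtE block_mxKdr subrr.
have Ds t : t <= t1 -> (D t)^T = D t.
  move=> tt; have [P1 [P21 [P1s PtE]]] := Pblock t tt.
  by rewrite /D ulsubB PtE block_mxKul linearB /= P1s Pp1s.
have Dric t : t <= t1 -> col_mx (D t) (dlsubmx (P t - Pp)) = L *m D t /\
    has_deriv_upto t1 D t (- (As^T *m D t + D t *m As - D t *m Q *m D t)).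
  move=> tt; have [dP Pd eqn] := gdre t tt.
  rewrite (riccati_difference _ gare) ET in eqn.
  rewrite -/(closed_loop A B Pp) -/Ap (PDblock t tt) -[dP]submxK ApE in eqn.
  have [DE dPE] := block_riccati eU (Ds t tt) eqn.
  split; first exact: DE.
  (* P and P - Pp have the same derivative. *)
  suff Dd : has_deriv_upto t1 D t (ulsubmx dP) by rewrite dPE in Dd.
  have := has_deriv_upto_ulsubmx
    (has_deriv_uptoD Pd (has_deriv_upto_cst t1 (- Pp) t)).
  by rewrite addr0.
have Dt1 : D t1 = S - ulsubmx Pp.
  rewrite /D ulsubB; congr (_ - _).
  rewrite /S -Pt1 ET -[P t1]submxK mulmx_block !block_mxKul.
  by rewrite mul1mx mul0mx addr0.
have defT : - (B *m B^T) = - T by [].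
pose H := hamiltonian a Ap12 c Ap2 T.
pose M1 := state_rec Ap12 c Ap2 T; pose M2 := costate_rec Ap12 Ap2.
have [Z [Zt1 Zd]] := linear_ode_exists H (col_mx 1%:M (S - ulsubmx Pp)) t1 t1.
have trE0 : (block_mx 1%:M 0 0 0 : 'M[R]_(d + q))^T = block_mx 1%:M 0 0 0.
  by rewrite -H1 ET H1.
have M1Z (Y : 'M[R]_(d + d, d)) : usubmx (M1 *m Y) = usubmx Y.
  by rewrite -{1}[Y]vsubmxK mul_block_col col_mxKu mul1mx mul0mx addr0.
have M2Z (Y : 'M[R]_(d + d, d)) : usubmx (M2 *m Y) = dsubmx Y.
  by rewrite -{1}[Y]vsubmxK mul_row_col mul0mx add0r mul_col_mx mul1mx col_mxKu.
have Zsol : solution (fun t => M1 *m Z t) (fun t => M2 *m Z t).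
  split.
  - move=> t tt; exists (col_mx M1 M2 *m (H *m Z t)).
      under eq_fun do rewrite -mul_col_mx.
      exact: has_deriv_upto_mull (Zd t).
    rewrite [col_mx M1 M2 *m _]mul_col_mx H1 trE0 ApE defT.
    apply/(hamiltonian_daeP _ _ _ _ eU).
    by rewrite !(M1Z, M2Z) !vsubmxK.
  - rewrite H1 -[M1 *m Z t1]vsubmxK M1Z Zt1 col_mxKu mul_block_col.
    by rewrite mul1mx !mul0mx !addr0.
  - rewrite H1 -[M2 *m Z t1]vsubmxK M2Z Zt1 col_mxKd mul_block_col.
    by rewrite mul1mx !mul0mx !addr0.
have solD W1 W2 t : solution W1 W2 -> t <= t1 ->
    let z s := col_mx (usubmx (W1 s)) (usubmx (W2 s)) in
    [/\ W1 t = M1 *m z t, W2 t = M2 *m z t & has_deriv_upto t1 z t (H *m z t)].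
  move=> [Wd _ _] tt z; have [dW Wdt] := Wd t tt.
  rewrite -[dW]vsubmxK H1 trE0 ApE defT => /(hamiltonian_daeP _ _ _ _ eU).
  move=> [W1E W2E zd]; split=> //; rewrite -[H *m _]zd.
  have W1d := has_deriv_upto_usubmx Wdt; have W2d := has_deriv_upto_dsubmx Wdt.
  have := has_deriv_upto_col_mx
    (has_deriv_upto_usubmx W1d) (has_deriv_upto_usubmx W2d).
  by under eq_fun do rewrite col_mxKu col_mxKd.
exists (fun t => M1 *m Z t), (fun t => M2 *m Z t); split=> //.
- move=> W1 W2 Wsol t tt.
  pose z s := col_mx (usubmx (W1 s)) (usubmx (W2 s)).
  have [W1E W2E _] := solD W1 W2 t Wsol tt.
  suff zE : z t = Z t by rewrite -zE.
  apply/eqP; rewrite -subr_eq0; apply/eqP.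
  apply/(@linear_ode_eq0 _ t1 _ _ (fun=> H) (fun s => z s - Z s) _ _ tt (lexx t1)).
  + by move=> s st; exists 0; exact: has_deriv_upto_cst.
  + move=> s st; rewrite mulmxBr.
    have [_ _ zd] := solD W1 W2 s Wsol st.
    exact: has_deriv_uptoD zd (has_deriv_uptoN (Zd s)).
  + rewrite /z Zt1; have [_ e1 e2] := Wsol.
    move: e1 e2; rewrite H1 -[W1 t1]vsubmxK -[W2 t1]vsubmxK !mul_block_col.
    rewrite !mul1mx !mul0mx !addr0 => /eq_col_mx[-> _] /eq_col_mx[-> _].
    by rewrite !col_mxKu subrr.
- move=> t tt.
  have V1d s : s <= t1 -> has_deriv_upto t1 (fun x => usubmx (Z x)) s
      (As *m usubmx (Z s) - Q *m dsubmx (Z s)).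
    have := has_deriv_upto_usubmx (Zd s).
    by rewrite -{1}[Z s]vsubmxK mul_block_col col_mxKu mulNmx.
  have V2d s : s <= t1 -> has_deriv_upto t1 (fun x => dsubmx (Z x)) s
      (- (As^T *m dsubmx (Z s))).
    have := has_deriv_upto_dsubmx (Zd s).
    by rewrite -{1}[Z s]vsubmxK mul_block_col col_mxKd mul0mx add0r mulNmx.
  have Dd s (st : s <= t1) := (Dric s st).2.
  have [||V1U DE] := riccati_linearization Dd V1d V2d _ _ tt.
  + by rewrite Zt1 col_mxKu.
  + by rewrite Zt1 col_mxKd Dt1.
  have [/= LD _] := Dric t tt; rewrite !(M1Z, M2Z).
  have D21E : dlsubmx (P t - Pp) = - (invmx Ap2^T *m Ap12^T *m D t).
    by move: LD; rewrite mul_col_mx mulNmx => /eq_col_mx[].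
  have PDE : P t - Pp = block_mx (D t) 0 (- (invmx Ap2^T *m Ap12^T *m D t)) 0.
    by rewrite -D21E; exact: PDblock.
  by split=> //; [exact: PDblock|rewrite -DE].
Qed.
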